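(* For every fat forest $\Delta$ there exist a numerical semigroup $S$ and an element $m\in S$ such that $\Delta$ is (up to relabeling vertices) the squarefree divisor complex $\Delta^S_m$.
   Context: All simplicial complexes are finite; facets are maximal faces. A simplicial complex $\Delta$ is a fat tree if its facets $F_1,F_2,\ldots$ can be ordered so that, for each $j \geq 2$, the intersection of $F_j$ with $F_1\cup\cdots\cup F_{j-1}$ is a simplex; here facets are regarded as subcomplexes (each $F_i$ together with all its subsets), and a simplex is the complex of all subsets of a single face. A fat forest is a disjoint union of (finitely many, at least one) fat trees, i.e. a union of fat trees on pairwise disjoint vertex sets. A numerical semigroup is a subset $S \subseteq \mathbb{Z}_{\ge 0}$ with finite complement that is closed under addition and contains $0$. It has a unique minimal generating set $\{n_1,\ldots,n_d\}$, consisting of its irreducible elements (the positive elements that are not sums of strictly smaller elements of $S$). Write $[d]=\{1,\ldots,d\}$, and for $F\subseteq[d]$ write $n_F=\sum_{i\in F}n_i$. For $m\in S$, the squarefree divisor complex of $m$ in $S$ is the simplicial complex $\Delta^S_m=\{F\subseteq[d] : m-n_F\in S\}$. Its vertices are the $i$ with $\{i\}\in\Delta^S_m$; not every $i\in[d]$ need be a vertex. *)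

(* Defs.v *)
From mathcomp Require Import all_boot.

Set Implicit Arguments.
Unset Strict Implicit.
Unset Printing Implicit Defensive.

Section SimplicialComplexes.

Variable V : finType.
Implicit Types D : {set {set V}}.

(* The ambient type V may contain points that are not vertices.  The complex  *)
(* [set set0] is allowed; the void collection set0 is not.                    *)
Definition simplicial_complex D : Prop :=
  set0 \in D /\ (forall F G : {set V}, F \in D -> G \subset F -> G \in D).

Definition vertices D : {set V} := [set v | [set v] \in D].

Definition facets D : {set {set V}} :=
  [set F | maxset [pred G : {set V} | G \in D] F].

(* A face F, regarded as a subcomplex, is powerset F.  The simplex along      *)
(* which a facet is attached may be powerset set0 = [set set0]; this only     *)
(* enlarges the class of fat trees, and leaves that of fat forests unchanged. *)
Definition fat_tree D : Prop :=
  simplicial_complex D /\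
  exists s : seq {set V},
    [/\ uniq s, s =i facets D &
        forall j, 0 < j < size s ->
          exists2 G : {set V}, G \in D &
            powerset (nth set0 s j)
              :&: \bigcup_(i < j) powerset (nth set0 s i) = powerset G].

Definition fat_forest D : Prop :=
  exists (k : nat) (T : 'I_k.+1 -> {set {set V}}),
    [/\ forall i, fat_tree (T i),
        forall i j, i != j -> [disjoint vertices (T i) & vertices (T j)] &
        D = \bigcup_i T i].

End SimplicialComplexes.

(* f only matters on the vertices of D, where it is a bijection onto the      *)
(* vertices of E.                                                             *)
Definition complex_iso (V W : finType) (D : {set {set V}}) (E : {set {set W}})
    : Prop :=
  exists f : V -> W,
    {in vertices D &, injective f} /\ [set f @: F | F : {set V} in D] = E.

Definition numerical_semigroup (S : {pred nat}) : Prop :=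
  [/\ 0 \in S,
      forall a b, a \in S -> b \in S -> a + b \in S &
      exists s : seq nat, forall x, x \notin S -> x \in s].

Definition irreducible_elt (S : {pred nat}) (x : nat) : Prop :=
  [/\ x \in S, 0 < x &
      forall s : seq nat, (forall a, a \in s -> a \in S /\ a < x) ->
        sumn s <> x].

Definition minimal_generators (S : {pred nat}) (d : nat) (n : d.-tuple nat)
    : Prop :=
  uniq n /\ (forall x, x \in n <-> irreducible_elt S x).

Definition generates (S : {pred nat}) (A : {pred nat}) : Prop :=
  forall x, x \in S <->
    exists2 s : seq nat, {subset s <= A} & sumn s = x.

Lemma minimal_generatorsP (S : {pred nat}) d (n : d.-tuple nat) :
  numerical_semigroup S -> minimal_generators S n ->
  generates S [in n] /\
  (forall A : {pred nat}, generates S A -> {subset n <= A}).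
Proof.
move=> [S0 SD _] [_ nP].
have Ssum (s : seq nat) : {subset s <= S} -> sumn s \in S.
  elim: s => [|a s IH] //= sS; apply: SD; first by apply: sS; rewrite mem_head.
  by apply: IH => b bs; apply: sS; rewrite inE bs orbT.
split=> [x | A gA x /nP [xS x0 xirr]].
  split=> [|[s sn <-]]; last first.
    by apply: Ssum => a /sn /nP [].
  have [k] := ubnP x; elim: k x => // k IH x /ltnSE xk xS.
  have [->|x0] := posnP x; first by exists [::].
  have [xn|xn] := boolP (x \in n).
    by exists [:: x]; rewrite /= ?addn0 // => a; rewrite inE => /eqP ->.
  have [/existsP [a /and3P [aS bS a0]]|no] :=
      boolP [exists a : 'I_x, [&& (a : nat) \in S, x - a \in S & 0 < a]].
    have [s1 s1n s1E] := IH a (leq_trans (ltn_ord a) xk) aS.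
    have lt : x - a < k by rewrite (leq_trans _ xk) // ltn_subrL a0 x0.
    have [s2 s2n s2E] := IH _ lt bS.
    exists (s1 ++ s2); last by rewrite sumn_cat s1E s2E subnKC // ltnW.
    by move=> b; rewrite mem_cat => /orP [/s1n|/s2n].
  case/negP: xn; apply/nP; split=> // s; elim: s => [|a s IHs] /= sS E.
    by rewrite -E in x0.
  have [aS ax] := sS a (mem_head _ _).
  have sS' b : b \in s -> b \in S /\ b < x.
    by move=> bs; apply: sS; rewrite inE bs orbT.
  have [a0|a0] := posnP a; first by apply: IHs; rewrite // -E a0.
  case/negP: no; apply/existsP; exists (Ordinal ax) => /=.
  by rewrite aS a0 -E addKn andbT; apply: Ssum => b /sS' [].
have AS a : a \in A -> a \in S.
  by move=> aA; apply/gA; exists [:: a]; rewrite /= ?addn0 // => b; rewrite inE => /eqP ->.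
have [s sA E] := (gA x).1 xS.
have [xs|xs] := boolP (x \in s); first exact: sA.
case: (xirr s) => // a as_; split; first exact/AS/sA.
rewrite ltn_neqAle (contraNneq _ xs) => [|<- //].
by rewrite -E sumnE (big_rem a) //= leq_addr.
Qed.

(* The condition on the left guards against truncated subtraction.            *)
Definition squarefree_divisor_complex (S : {pred nat}) (d : nat)
    (n : d.-tuple nat) (m : nat) : {set {set 'I_d}} :=
  [set F : {set 'I_d} | let nF := \sum_(i in F) tnth n i in
                        (nF <= m) && (m - nF \in S)].

(* Main.v *)
Require Import Defs.
From mathcomp Require Import all_boot.
From mathcomp Require Import zify.

(** If a semigroup contains all integers above m, and its elements up to m are
    the sums of some irreducible and distinct weights n v, then the faces of
    the squarefree divisor complex of m are the subsets of the supports of the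
    factorizations m = \sum_v x v * n v.  So it suffices to find such weights
    on the vertices of the given complex, and a target m, for which these
    supports generate the complex; all integers above m are then adjoined to
    make the complement finite, and they cannot occur in a factorization of m.

    The weights are found by building the complex one vertex at a time.  The
    induction carries two more properties of a face F, whose weight is the sum
    of the n v for v in F: every factorization of this weight is supported in F
    (for single vertices this makes the n v irreducible and distinct), and
    twice this weight is less than m.  There are two steps, each of which
    multiplies the old weights and the target by a large t and chooses the new
    weights so that few of their combinations are multiples of t.
    - attach_vertex glues a simplex w |: G along a face G.  With g the weight of
      G, the new vertex w weighs r = m - g, with t coprime to r.  Then w occurs
      a multiple of t times; t copies of w leave t * g to be factored, which can
      only be done inside G, and 2 t copies are too heavy.
    - double_vertex replaces a vertex w by two vertices which are in the same
      faces, with weights q and N such that q + N = t * n w, both coprime to t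
      and larger than m.  Modulo t these weights are opposite, so in a
      factorization of t * m both occur equally often, as often as w did.
    A facet that meets the previous ones in a face G (possibly empty, at the
    start of a new tree) is glued by attaching one vertex to G and then doubling
    this vertex until all new vertices are there (attach_face). *)

Set Implicit Arguments.
Unset Strict Implicit.
Unset Printing Implicit Defensive.

(** * Weights realizing a simplicial complex *)

Section Realization.

Variable V : finType.
Implicit Types (K D : {set {set V}}) (F G U : {set V}) (n x : V -> nat).
Implicit Types (u v w : V) (m : nat).

Definition value U n x := \sum_(v in U) x v * n v.

Definition support U x : {set V} := [set v in U | 0 < x v].

Definition ind F : V -> nat := fun v => v \in F.

(** The empty face is exempted from [realizes_face] so that the induction can
    start from the complex with only this face: its target has to be positive
    by [realizes_small], hence has no factorization.  [realizes_tight] and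
    [realizes_small] are what the gluing steps need in order to control the
    factorizations that use a new vertex. *)
Record realizes U K n m : Prop := Realizes {
  realizes_pos : forall v, v \in U -> 0 < n v;
  realizes_support : forall x, value U n x = m -> support U x \in K;
  realizes_face : forall F, F \in K -> F != set0 ->
    exists2 x, value U n x = m & F \subset support U x;
  realizes_tight : forall F x, F \in K ->
    value U n x = value U n (ind F) -> support U x \subset F;
  realizes_small : forall F, F \in K -> 2 * value U n (ind F) < m }.

Definition realizable K : Prop :=
  simplicial_complex K /\ exists n m, realizes (vertices K) K n m.

Lemma eq_value U n x y : {in U, x =1 y} -> value U n x = value U n y.
Proof. by move=> E; apply: eq_bigr => v /E ->. Qed.

Lemma valueD U n x y :
  value U n (fun v => x v + y v) = value U n x + value U n y.
Proof.
by rewrite /value -big_split /=; apply: eq_bigr => v _; rewrite mulnDl.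
Qed.

Lemma value_ind U n F : F \subset U -> value U n (ind F) = \sum_(v in F) n v.
Proof.
move=> FU; rewrite /value (big_setID F) /= (setIidPr FU).
rewrite [X in _ + X]big1 ?addn0 => [|v /setDP [_ /negbTE vF]]; last first.
  by rewrite /ind vF.
by apply: eq_bigr => v vF; rewrite /ind vF mul1n.
Qed.

Lemma value_ge U n x v : v \in U -> x v * n v <= value U n x.
Proof. by move=> vU; rewrite /value (bigD1 v) //= leq_addr. Qed.

Lemma face_vertices K F :
  simplicial_complex K -> F \in K -> F \subset vertices K.
Proof.
move=> [_ Kd] FK; apply/subsetP => v vF; rewrite inE.
by apply: Kd FK _; rewrite sub1set.
Qed.

Lemma complexU K D :
  simplicial_complex K -> simplicial_complex D -> simplicial_complex (K :|: D).
Proof.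
move=> [K0 Kd] [_ Dd]; split=> [|F G]; first by rewrite inE K0.
rewrite !inE => /orP [FK|FD] GF; first by rewrite (Kd F).
by rewrite (Dd F) ?orbT.
Qed.

Lemma complex_powerset F : simplicial_complex (powerset F).
Proof.
split=> [|G H]; rewrite !inE ?sub0set // => GF HG.
exact: subset_trans HG GF.
Qed.

Lemma verticesU K D : vertices (K :|: D) = vertices K :|: vertices D.
Proof. by apply/setP => v; rewrite !inE. Qed.

Lemma vertices_powerset F : vertices (powerset F) = F.
Proof. by apply/setP => v; rewrite !inE sub1set. Qed.

(** * Gluing a new vertex to a face *)

Lemma coprime_scaled_sum t r j a b :
  0 < t -> coprime t r -> j * r + t * a = t * b ->
  exists2 k, j = k * t & k * r + a = b.
Proof.
move=> t0 co E.
have /dvdnP [k jE] : t %| j.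
  rewrite -(Gauss_dvdl _ co) -(dvdn_addl _ (dvdn_mulr a (dvdnn t))) E.
  exact: dvdn_mulr.
exists k => //; apply/eqP; rewrite -(eqn_pmul2l t0) -E jE.
by rewrite mulnDr mulnA (mulnC t).
Qed.

Lemma coprime_doubleS r : coprime r.*2.+1 r.
Proof. by rewrite -addn1 -mul2n /coprime gcdnC gcdnMDl gcdn1. Qed.

(** The new vertex weighs r = m - g, where g is the weight of G, and the old
    weights are multiplied by t = 2 r + 1, which is coprime to r.  A
    factorization of t * m uses k * t copies of w, with k * r <= m, and k <= 1
    since 2 * g < m.  If k = 1 then the old vertices contribute t * g, hence
    their support lies in G. *)
Lemma attach_vertex K G w :
  realizable K -> G \in K -> w \notin vertices K ->
  realizable (K :|: powerset (w |: G)).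
Proof.
move=> [Kc [n [m R]]] GK wK; split.
  by apply: complexU => //; apply: complex_powerset.
rewrite verticesU vertices_powerset setUCA (setUidPl (face_vertices Kc GK)).
move: R wK (fun F => @face_vertices K F Kc); move: (vertices K) => U R wK KU.
have [_ Kd] := Kc; have GU := KU G GK.
set g := value U n (ind G).
have gm : 2 * g < m := realizes_small R GK.
set r := m - g; set t := r.*2.+1.
have co : coprime t r := coprime_doubleS r.
pose n' v := if v == w then r else t * n v.
have val' x : value (w |: U) n' x = x w * r + t * value U n x.
  rewrite /value big_setU1 //= {1}/n' eqxx big_distrr /=; congr (_ + _).
  apply: eq_bigr => v vU; rewrite /n' ifN; first by rewrite mulnCA.
  by apply: contraNneq wK => <-.
have supp' x (H : {set V}) :
    support U x \subset H -> support (w |: U) x \subset w |: H.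
  move=> /subsetP S; apply/subsetP => v; rewrite !inE.
  by case: eqP => //= _ vx; apply: S; rewrite inE.
have supp0 x : x w = 0 -> support (w |: U) x = support U x.
  move=> x0; apply/setP => v; rewrite !inE; case: eqP => //= ->.
  by rewrite x0 andbF.
have lt_r F : F \in K -> value U n (ind F) < r.
  by move=> /(realizes_small R) Fm; rewrite /r; lia.
have indK F : F \in K -> ind F w = 0.
  move=> FK; rewrite /ind; case: (boolP (w \in F)) => // wF.
  by rewrite (subsetP (KU F FK)) in wK.
(* A new face that contains w is w |: A with A below G. *)
have shape F : F \in K :|: powerset (w |: G) ->
    F \in K \/ exists2 A : {set V}, A \subset G & F = w |: A.
  rewrite !inE => /orP [|FG]; first by left.
  case: (boolP (w \in F)) => wF; [right|left].
    by exists (F :\ w); rewrite ?setD1K // subDset.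
  by apply: Kd GK _; move: FG; rewrite -subDset (setDidPl _) //
    disjoint_sym disjoints1.
have indw A : ind (w |: A) w = 1 by rewrite /ind setU11.
have indU A : value U n (ind (w |: A)) = value U n (ind A).
  apply: eq_value => v vU; rewrite /ind !inE; case: eqP => // E.
  by rewrite E (negbTE wK) in vU *.
exists n', (t * m); split.
- move=> v; rewrite !inE /n' => /predU1P [->|vU]; first by rewrite eqxx /r; lia.
  by case: ifP => _; [rewrite /r; lia | rewrite muln_gt0 (realizes_pos R)].
- move=> x; rewrite val' => /(coprime_scaled_sum (ltn0Sn _) co) [k xE E].
  rewrite !inE; case: k xE E => [|[|k]] xE E.
  + by rewrite supp0 // (realizes_support R).
  + rewrite supp' ?orbT //; apply: (realizes_tight R) => //.
    by rewrite -/g; rewrite /r in E; lia.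
  + by rewrite /r in E; nia.
- move=> F /shape [FK F0|[A AG ->] _].
    have [x xm Fx] := realizes_face R FK F0.
    pose y v := if v == w then 0 else x v.
    have yx : value U n y = value U n x.
      by apply: eq_value => v vU; rewrite /y ifN //; apply: contraNneq wK => <-.
    exists y; first by rewrite val' yx xm /y eqxx.
    rewrite supp0 ?/y ?eqxx //; apply/subsetP => v /(subsetP Fx); rewrite !inE.
    by case: eqP => [->|]; rewrite ?(negbTE wK).
  pose y v := if v == w then t else ind G v.
  exists y.
    have gm' : g <= m by lia.
    rewrite val' {1}/y eqxx -mulnDr -(subnK gm').
    congr (_ * (_ + _)); apply: eq_value => v vU.
    by rewrite /y ifN //; apply: contraNneq wK => <-.
  apply/subsetP => v; rewrite !inE /y /ind; case: eqP => //= _ /(subsetP AG) vG.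
  by rewrite vG (subsetP GU).
- have tight F x j : F \in K ->
      j * r + t * value U n x = t * value U n (ind F) ->
      j = 0 /\ support U x \subset F.
    move=> FK /(coprime_scaled_sum (ltn0Sn _) co) [[|k] jE E].
      by split=> //; apply: (realizes_tight R).
    by have := lt_r F FK; nia.
  move=> F x /shape [FK|[A /(Kd _ _ GK) AK ->]]; rewrite !val'.
    by rewrite indK // => /tight [] // x0 S; rewrite supp0.
  rewrite indU indw mul1n => E.
  case xE : (x w) => [|j].
    have : t %| r.
      rewrite -(dvdn_addl _ (dvdn_mulr (value U n (ind A)) (dvdnn t))) -E xE.
      exact: dvdn_mulr.
    by move=> /dvdn_leq; rewrite /t /r; lia.
  have [|_ S] := tight A x j AK; first by rewrite xE in E; lia.
  exact: supp'.
- move=> F /shape [FK|[A /(Kd _ _ GK) AK ->]]; rewrite val'.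
    by have := realizes_small R FK; rewrite indK //; nia.
  by have := realizes_small R AK; rewrite indU indw /t; nia.
Qed.

(** * Doubling a vertex *)

(** Modulo t the numbers q and N are opposite units, so t divides e - f.  A
    nonzero difference would contribute at least t * q or t * N, more than
    t * m. *)
Lemma balanced_scaled_sum t q N c m e f a b :
  0 < t -> coprime t q -> coprime t N -> m < q -> m < N -> t * c = q + N ->
  b <= m -> e * q + f * N + t * a = t * b -> e = f /\ e * c + a = b.
Proof.
move=> t0; wlog le_fe : q N e f / f <= e => [IH|].
  case/orP: (leq_total f e) => [|le_ef]; first exact: IH.
  move=> cq cN mq mN tc bm E.
  rewrite addnC in tc; rewrite (addnC (e * q)) in E.
  by have [fe <-] := IH N q f e le_ef cN cq mN mq tc bm E; rewrite fe.
move=> cq _ mq _ tc bm E.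
have [|k jE kE] := @coprime_scaled_sum t q (e - f) (f * c + a) b t0 cq.
  rewrite mulnDr mulnCA tc -E mulnBl mulnDr.
  by have := leq_mul le_fe (leqnn q); lia.
case: k jE kE => [|k] jE kE; last by have := leq_addr (k * q) q; lia.
by have -> : e = f by lia.
Qed.

Lemma cross_sum t q N c a b i j r k : t * c = q + N ->
  a * q + b * N + t * r = i * q + j * N + t * k ->
  (a + j) * q + (b + i) * N + t * r = t * ((i + j) * c + k).
Proof. by move=> tc E; rewrite mulnDr mulnCA tc !mulnDl !mulnDr; lia. Qed.

Lemma split_weight m c : 0 < c ->
  exists t q N,
    [/\ 0 < t, m < q, m < N, t * c = q + N & coprime t q /\ coprime t N].
Proof.
move=> c0; set q := m.+1; set t := q.*2.+1.
have tc_ge : t <= t * c by rewrite leq_pmulr.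
have tc : t * c = q + (t * c - q) by lia.
have cq : coprime t q := coprime_doubleS q.
exists t, q, (t * c - q); split=> //; first by lia.
split=> //; rewrite /coprime -dvdn1 -(eqP cq) dvdn_gcd dvdn_gcdl /=.
by rewrite -(dvdn_addl _ (dvdn_gcdr t _)) -tc dvdn_mulr // dvdn_gcdl.
Qed.

(** The new complex is the preimage of the old one under the map that sends w'
    to w and fixes the other vertices.  By [balanced_scaled_sum], factorizations
    of t * m in the new weights correspond to those of m in the old ones.

    For a face F containing exactly one of w and w', the weight of F is not a
    multiple of t.  Adding the weight of the missing one to both sides of an
    equation between this weight and a factorization makes the coefficients
    comparable.  The resulting multiple of t is at most t * m because twice the
    old weight of the image of F is less than m. *)
Lemma double_vertex K w w' :
  realizable K -> w \in vertices K -> w' \notin vertices K ->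
  realizable
    [set F : {set V} | [set (if v == w' then w else v) | v in F] \in K].
Proof.
move=> [Kc [n [m R]]]; set pi := fun v => if v == w' then w else v.
set K' := [set F : {set V} | _] => wK w'K.
have [K0 Kd] := Kc; split.
  split=> [|F G]; rewrite !inE ?imset0 // => FK GF.
  exact: Kd FK (imsetS pi GF).
have -> : vertices K' = w' |: vertices K.
  apply/setP => v; rewrite !inE imset_set1 /pi; case: eqP => [->|] //.
  by rewrite inE in wK.
move: R wK w'K; move: (vertices K) => U R wU w'U.
have ww' : w != w' by apply: contraNneq w'U => <-.
have inpi F v : v \in U :\ w -> (v \in pi @: F) = (v \in F).
  move=> /setD1P [vw vU]; have vw' : v != w' by apply: contraNneq w'U => <-.
  apply/imsetP/idP => [[u uF]|vF]; last by exists v; rewrite /pi ?(negbTE vw').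
  by rewrite /pi; case: eqP => [_ E|_ -> //]; rewrite E eqxx in vw.
have inpiw F : (w \in pi @: F) = (w' \in F) || (w \in F).
  apply/imsetP/orP => [[u uF]|[uF|uF]].
  - by rewrite /pi; case: eqP => [<- _|_ ->]; [left|right].
  - by exists w' => //; rewrite /pi eqxx.
  - by exists w => //; rewrite /pi (negbTE ww').
set c := n w; have c0 : 0 < c := realizes_pos R wU.
have [t [q [N [t0 mq mN tc [cq cN]]]]] := split_weight m c0.
pose n' v := if v == w' then q else if v == w then N else t * n v.
pose rest x := value (U :\ w) n x.
have valU x : value U n x = x w * c + rest x by rewrite /value (big_setD1 w).
have val' x : value (w' |: U) n' x = x w' * q + x w * N + t * rest x.
  rewrite /value big_setU1 //= (big_setD1 w) //= addnA.
  rewrite /n' eqxx (negbTE ww') eqxx; congr (_ + _).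
  rewrite /rest /value big_distrr; apply: eq_bigr => v /setD1P [vw vU] /=.
  have vw' : v != w' by apply: contraNneq w'U => <-.
  by rewrite (negbTE vw') (negbTE vw) mulnCA.
have restpi F : rest (ind (pi @: F)) = rest (ind F).
  by apply: eq_value => v /inpi E; rewrite /ind E.
have tight A k x : A \in K -> k * c + rest x = value U n (ind A) ->
    (0 < k -> w \in A) /\ {in U :\ w, forall v, 0 < x v -> v \in A}.
  move=> AK E; pose y v := if v == w then k else x v.
  have /subsetP S : support U y \subset A.
    apply: (realizes_tight R) => //; rewrite -E valU /y eqxx; congr (_ + _).
    by apply: eq_value => v /setD1P [/negbTE ->].
  split=> [k0|v /setD1P [vw vU] xv]; apply: S; rewrite inE ?wU ?vU /y ?eqxx //.
  by rewrite (negbTE vw).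
have indE (F : {set V}) v : ind F v = (v \in F) by [].
exists n', (t * m); split.
- move=> v; rewrite /n' => /setU1P [->|vU]; first by rewrite eqxx; lia.
  case: ifP => _; first by lia.
  case: ifP => _; first by lia.
  by rewrite muln_gt0 t0 (realizes_pos R).
- move=> x; rewrite val' => E.
  have [eab bE] := balanced_scaled_sum t0 cq cN mq mN tc (leqnn m) E.
  have SK : support U x \in K by apply: (realizes_support R); rewrite valU -eab.
  rewrite inE; apply: Kd SK _; apply/subsetP => _ /imsetP [v vS ->].
  move: vS; rewrite !inE /pi; case: eqP => [-> /= | _ //=].
  by rewrite eab wU.
- move=> F; rewrite inE => FK F0.
  have [|x xm Fx] := realizes_face R FK; first by rewrite imset_eq0.
  exists (x \o pi).
    rewrite val' /= /pi eqxx (negbTE ww') -mulnDr -tc mulnCA -mulnDr -xm valU.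
    congr (_ * (_ + _)); apply: eq_value => v /setD1P [_ vU] /=.
    by rewrite ifN //; apply: contraNneq w'U => <-.
  apply/subsetP => v vF.
  have := subsetP Fx _ (imset_f pi vF); rewrite !inE /= /pi.
  by case: eqP => // _ /andP [_ ->].
- move=> F x; rewrite inE !val' => FK E.
  set a := x w' in E; set b := x w in E.
  have : 2 * value U n (ind (pi @: F)) < m := realizes_small R FK.
  have DK : pi @: F :\ w \in K by apply: Kd FK (subD1set _ _).
  have valD : value U n (ind (pi @: F :\ w)) = rest (ind F).
    rewrite valU !indE setD11 add0n -(restpi F); apply: eq_value => v.
    by move=> /setD1P [vw _]; rewrite !indE in_setD1 vw.
  rewrite valU restpi !indE inpiw => small.
  (* Add q once if w is in F, and N once if w' is in F: the right hand side
     becomes a multiple of t whichever of w and w' are in F. *)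
  have [||eab bE] := @balanced_scaled_sum t q N c m (a + ind F w) (b + ind F w')
    (rest x) ((ind F w' + ind F w) * c + rest (ind F))
    t0 cq cN mq mN tc.
  + apply: leq_trans (ltnW small); rewrite mulnDr mulnA leq_add ?leq_pmull //.
    by rewrite leq_mul2r !indE orbC; case: (w' \in F); case: (w \in F).
  + exact: cross_sum tc E.
  suff [wF' wF vF] : [/\ 0 < x w' -> w' \in F, 0 < x w -> w \in F &
      {in U :\ w, forall v, 0 < x v -> v \in F}].
    apply/subsetP => v; rewrite inE => /andP [/setU1P [->|vU] //].
    by have [->|vw] := eqVneq v w => //; apply: vF; rewrite in_setD1 vw.
  move: eab bE; rewrite !indE -/a -/b.
  (* Unless both w and w' are in F, the less frequent of the two must be shown
     absent: tightness is applied to the image of F without w. *)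
  case w'F: (w' \in F); case wF: (w \in F) => /= eab bE.
  + have [|_ S] := tight _ b x FK.
      by rewrite valU restpi indE inpiw w'F; lia.
    by split=> // v vU /(S v vU); rewrite inpi.
  + have [|k0 S] := tight _ b x DK.
      by rewrite valD; rewrite eab in bE; clear -bE; lia.
    split=> // [/k0|v vU /(S v vU)]; first by rewrite setD11.
    by rewrite in_setD1 inpi // => /andP [].
  + have [|k0 S] := tight _ a x DK; first by rewrite valD; clear -bE; lia.
    split=> // [/k0|v vU /(S v vU)]; first by rewrite setD11.
    by rewrite in_setD1 inpi // => /andP [].
  + have [|k0 S] := tight _ b x DK.
      by rewrite valD; rewrite eab in bE; clear -bE; lia.
    have ab : a = b by rewrite !addn0 in eab.
    split=> [|/k0|v vU /(S v vU)]; last by rewrite in_setD1 inpi // => /andP [].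
      by rewrite -/a ab => /k0; rewrite setD11.
    by rewrite setD11.
- move=> F; rewrite inE => FK; rewrite val'.
  have := realizes_small R FK; rewrite valU restpi !indE inpiw.
  rewrite -(ltn_pmul2l t0); apply: leq_ltn_trans; rewrite mulnCA leq_mul2l /=.
  rewrite mulnDr leq_add2r mulnCA tc !mulnDr.
  by case: (w' \in F); case: (w \in F) => /=;
    rewrite ?mul0n ?mul1n ?add0n ?addn0 ?leq_addr ?leq_addl.
Qed.

(** * Fat forests *)

(** If the new vertices are w and the entries of s, first w is attached to G,
    and then each entry of s is created as a double of w.  Doubling w affects
    only faces of the new simplex, since w is not a vertex of K. *)
Lemma attach_face K G F :
  realizable K -> G \in K -> G \subset F ->
  {in F, forall v, v \in vertices K -> v \in G} ->
  realizable (K :|: powerset F).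
Proof.
move=> RK GK GF new; have [[_ Kd] _] := RK.
have [FG|[w wFG]] := set_0Vmem (F :\: G).
  have -> : F = G by apply/eqP; rewrite eqEsubset GF andbT -setD_eq0 FG.
  rewrite (setUidPl _) //; apply/subsetP => H; rewrite inE; exact: Kd.
have fresh v : v \in F :\: G -> v \notin vertices K.
  by case/setDP => vF; apply: contra; apply: new.
suff grow s : {subset s <= F :\: G} ->
    realizable (K :|: powerset ([set v in w :: s] :|: G)).
  have -> : F = [set v in w :: enum (F :\: G)] :|: G.
    apply/setP => v; rewrite !inE mem_enum !inE.
    case: (boolP (v \in G)) => [vG|vG] /=; first by rewrite (subsetP GF) ?orbT.
    by case: eqP => [->|_]; rewrite ?orbF //=; case/setDP: wFG.
  by apply: grow => v; rewrite mem_enum.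
elim: s => [_|w' s IH sFG].
  have -> : [set v in [:: w]] = [set w] by apply/setP => v; rewrite !inE.
  exact: attach_vertex (fresh w wFG).
have {}IH : realizable (K :|: powerset ([set v in w :: s] :|: G)).
  by apply: IH => v vs; apply: sFG; rewrite inE vs orbT.
have w'FG := sFG w' (mem_head _ _).
set H := [set v in w :: s] :|: G in IH.
have [w'H|w'H] := boolP (w' \in H).
  suff -> : [set v in [:: w, w' & s]] :|: G = H by [].
  apply/setP => v; move: w'H; rewrite !inE.
  by case: (v =P w') => [->|_ _] //=; rewrite ?orbT.
have -> : [set v in [:: w, w' & s]] :|: G = w' |: H.
  by apply/setP => v; rewrite !inE -!orbA orbCA.
have -> : K :|: powerset (w' |: H) =
    [set E : {set V} | [set (if v == w' then w else v) | v in E]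
                       \in K :|: powerset H].
  apply/setP => E; rewrite !inE; set pi := fun v => _.
  have wH : w \in H by rewrite !inE eqxx.
  have [w'E|w'E] := boolP (w' \in E); last first.
    have -> : pi @: E = E.
      rewrite (@eq_in_imset _ _ _ id) ?imset_id // => v vE.
      by rewrite /pi ifN //; apply: contraNneq w'E => <-.
    by rewrite -subDset (setDidPl _) // disjoint_sym disjoints1.
  have notK v (X : {set V}) : v \in F :\: G -> v \in X -> (X \in K) = false.
    move=> /fresh vK vX; apply: contraNF vK => XK.
    by rewrite inE (Kd X) // sub1set.
  rewrite (notK _ _ w'FG w'E) (notK _ _ wFG) /=; last first.
    by apply/imsetP; exists w'; rewrite /pi ?eqxx.
  apply/subsetP/subsetP => [EH _ /imsetP [v /EH vH ->]|EH v vE].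
    by move: vH; rewrite /pi in_setU1; case: eqP.
  have := EH _ (imset_f pi vE); rewrite /pi in_setU1.
  by case: eqP.
apply: double_vertex IH _ _; rewrite verticesU vertices_powerset.
  by rewrite !inE eqxx orbT.
by rewrite in_setU negb_or fresh.
Qed.

(** The facets of the tree are attached in their given order.  The first one is
    glued along the empty face, so the same argument covers the start of a new
    component. *)
Lemma attach_fat_tree K T :
  realizable K -> fat_tree T -> [disjoint vertices K & vertices T] ->
  realizable (K :|: T).
Proof.
move=> RK [[T0 Td] [s [us sT glue]]] KT.
have sub i : i < size s -> powerset (nth set0 s i) \subset T.
  move=> /(mem_nth set0); rewrite sT inE => /maxsetP [FT _].
  by apply/subsetP => G; rewrite inE; apply: Td.
have -> : T = \bigcup_(i < size s) powerset (nth set0 s i).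
  apply/setP => F; apply/idP/bigcupP => [FT|[i _]]; last exact/subsetP/sub.
  have [G Gmax FG] := @maxset_exists _ [pred G : {set V} | G \in T] F FT.
  have Gs : G \in s by rewrite sT inE.
  have ilt : index G s < size s by rewrite index_mem.
  by exists (Ordinal ilt); rewrite //= nth_index // inE.
move: (leqnn (size s)); move: {-2}(size s) => j.
elim: j => [_|j IH js]; first by rewrite big_ord0 setU0.
rewrite big_ord_recr /= setUA; set F := nth set0 s j.
set L := \bigcup_(i < j) _ in IH *.
have LT : L \subset T.
  by apply/bigcupsP => i _; apply: sub; apply: ltn_trans (ltn_ord i) js.
have {}IH : realizable (K :|: L) by apply: IH; apply: ltnW.
have [G [GL GF] LF] : exists2 G,
    G \in K :|: L /\ G \subset F & powerset F :&: L \subset powerset G.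
  case: (posnP j) => [j0|j0].
    exists set0; first by rewrite sub0set; have [[]] := IH.
    by rewrite /L j0 big_ord0 setI0 sub0set.
  have [|G _ E] := glue j; first by rewrite j0.
  exists G; last by rewrite -E.
  have : G \in powerset G by rewrite inE.
  by rewrite -E !inE => /andP [-> ->]; rewrite orbT.
apply: attach_face IH GL GF _ => v vF; rewrite verticesU => /setUP [vK|vL].
  have vT : v \in vertices T.
    by rewrite inE (subsetP (sub j js)) // inE sub1set.
  by rewrite (disjointFr KT vK) in vT.
rewrite -sub1set -powersetE; apply: (subsetP LF).
by rewrite in_setI powersetE sub1set vF; rewrite inE in vL.
Qed.

Lemma realizable_set0 : realizable [set set0].
Proof.
split; first by split=> [|F G]; rewrite !inE // => /eqP ->; rewrite subset0.
have -> : vertices [set set0 : {set V}] = set0.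
  apply/setP => v; rewrite !inE; apply/negP => /eqP /setP /(_ v).
  by rewrite !inE eqxx.
have value0 n x : value set0 n x = 0 by rewrite /value big_set0.
exists (fun=> 1), 1; split=> //.
- by move=> x; rewrite value0.
- by move=> F; rewrite inE => /eqP ->; rewrite eqxx.
- by move=> F x _ _; apply/subsetP => v; rewrite !inE.
- by move=> F _; rewrite value0.
Qed.

Lemma realizable_fat_forest D : fat_forest D -> realizable D.
Proof.
case=> k [T [treeT disjT ->]].
suff IH j : j <= k.+1 ->
    realizable ([set set0] :|: \bigcup_(i < k.+1 | i < j) T i).
  have E : \bigcup_(i < k.+1 | i < k.+1) T i = \bigcup_i T i.
    by apply: eq_bigl => i; rewrite ltn_ord.
  have := IH k.+1 (leqnn _); rewrite E (setUidPr _) // sub1set.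
  by apply/bigcupP; exists ord0; rewrite //; have [[]] := treeT ord0.
elim: j => [_|j IH jk].
  by rewrite big_pred0 // setU0; apply: realizable_set0.
rewrite (bigD1 (Ordinal jk)) //= [T _ :|: _]setUC setUA.
rewrite (eq_bigl (fun i : 'I_k.+1 => i < j)) => [|i]; last first.
  by rewrite -(inj_eq val_inj) /= ltnS; case: ltngtP.
apply: attach_fat_tree => //; first by apply: IH; apply: ltnW.
rewrite disjoint_subset; apply/subsetP => v; rewrite !inE.
case/orP => [/eqP /setP /(_ v)|/bigcupP [i ij vi]]; first by rewrite !inE eqxx.
have ij_disj : [disjoint vertices (T i) & vertices (T (Ordinal jk))].
  by apply: disjT; rewrite -(inj_eq val_inj) /= ltn_eqF.
by have := disjointFr ij_disj (x := v); rewrite !inE => ->.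
Qed.

(** * The semigroup of a realization *)

Section Semigroup.

Variables (U : {set V}) (n : V -> nat) (m : nat).

Hypothesis n_pos : {in U, forall v, 0 < n v}.

Definition represented a : bool :=
  [exists x : {ffun V -> 'I_a.+1}, value U n (fun v => x v) == a].

Definition truncated_semigroup : {pred nat} :=
  [pred a | (m < a) || represented a].

Local Notation S := truncated_semigroup.

Lemma representedP a : reflect (exists x, value U n x = a) (represented a).
Proof.
apply: (iffP existsP) => [[x /eqP xa]|[x xa]].
  by exists (fun v => nat_of_ord (x v)).
exists [ffun v => inord (x v)]; apply/eqP; rewrite -[RHS]xa.
apply: eq_value => v vU; rewrite ffunE inordK // ltnS -xa.
by apply: leq_trans (value_ge n x vU); rewrite leq_pmulr ?n_pos.
Qed.

Lemma truncated_semigroup_small a : a <= m -> (a \in S) = represented a.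
Proof. by rewrite inE leqNgt => /negbTE ->. Qed.

Lemma truncated_semigroupP : numerical_semigroup S.
Proof.
split.
- rewrite inE; apply/orP; right; apply/representedP; exists (fun=> 0).
  by rewrite /value big1.
- move=> a b; rewrite !inE.
  case/orP => [ma _|/representedP [x xa]]; first by rewrite ltn_addr.
  case/orP => [mb|/representedP [y yb]]; first by rewrite ltn_addl.
  apply/orP; right; apply/representedP; exists (fun v => x v + y v).
  by rewrite valueD xa yb.
- exists (iota 0 m.+1) => x; rewrite inE negb_or -leqNgt => /andP [xm _].
  by rewrite mem_iota.
Qed.

End Semigroup.

End Realization.

(** It is enough to consider sums of two elements, since all terms but one of a
    longer sum add up to an element of the semigroup. *)
Lemma irreducible_eltP (S : {pred nat}) x : numerical_semigroup S ->
  irreducible_elt S x <->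
  [/\ x \in S, 0 < x &
      forall a b, a \in S -> b \in S -> a + b = x -> a = 0 \/ b = 0].
Proof.
case=> S0 SD _; split=> [[xS x0 irr]|[xS x0 irr]]; split=> //.
  move=> a b aS bS ab; case: (posnP a); [by left|case: (posnP b); [by right|]].
  move=> b0 a0; case: (irr [:: a; b]); last by rewrite /= addn0.
  by move=> c; rewrite !inE => /orP [] /eqP ->; split=> //; lia.
elim=> [|a s IH] /= sS E; first by rewrite -E in x0.
have sumS (t : seq nat) : {subset t <= S} -> sumn t \in S.
  elim: t => [|b t IHt] //= tS; apply: SD; first by rewrite tS ?mem_head.
  by apply: IHt => c ct; rewrite tS // inE ct orbT.
have [aS ax] := sS a (mem_head _ _).
have sS' b : b \in s -> b \in S /\ b < x.
  by move=> bs; apply: sS; rewrite inE bs orbT.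
case: (irr a (sumn s)) => // [|a0|s0].
- by apply: sumS => b /sS' [].
- by apply: IH => //; rewrite -E a0.
- by rewrite -E s0 addn0 ltnn in ax.
Qed.

(** If all integers from N on belong to S, an element x > 2 * N splits as
    N + (x - N), so the irreducible elements are at most 2 * N. *)
Lemma minimal_generators_exist (S : {pred nat}) : numerical_semigroup S ->
  exists d (n : d.-tuple nat), minimal_generators S n.
Proof.
move=> HS; have [S0 SD [gaps gapsP]] := HS.
pose N := (\max_(a <- gaps) a).+1.
have bigS a : N <= a -> a \in S.
  move=> Na; apply: contraLR Na => /gapsP ag; rewrite -ltnNge ltnS.
  exact: (@leq_bigmax_seq _ _ xpredT id).
pose irr x := [&& x \in S, 0 < x &
  all (fun a => (a \in S) && (x - a \in S) ==> (a == 0) || (a == x))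
      (iota 0 x.+1)].
have irrP x : reflect (irreducible_elt S x) (irr x).
  apply: (iffP and3P) =>
      [[xS x0 /allP irrx]|/(irreducible_eltP x HS) [xS x0 irrx]].
    apply/(irreducible_eltP x HS); split=> // a b aS bS ab.
    have := irrx a; rewrite mem_iota aS -ab addKn bS /= add0n ltnS leq_addr.
    by move=> /(_ isT) /orP [] /eqP; lia.
  split=> //; apply/allP => a; rewrite mem_iota ltnS => /andP [_ ax].
  apply/implyP => /andP [aS bS]; apply/orP.
  by case: (irrx a (x - a)) => // [|->|]; [lia|left|right; apply/eqP; lia].
exists _, (in_tuple [seq x <- iota 0 (2 * N).+1 | irr x]); split.
  by rewrite filter_uniq ?iota_uniq.
move=> x; rewrite memtE mem_filter mem_iota /= add0n.
split=> [/andP [/irrP]|xI] //; apply/andP; split; first exact/irrP.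
rewrite ltnS leqNgt; apply/negP => Nx.
have /(irreducible_eltP x HS) [_ _ irrx] := xI.
by case: (irrx N (x - N)); rewrite ?bigS //; lia.
Qed.

(** A vertex is sent to the index of its weight among the minimal generators.
    The weights are irreducible and distinct by the last hypothesis.  A
    generator up to m is one of them, being irreducible and a sum of weights,
    and a generator above m is in no face. *)
Lemma semigroup_realization (V : finType) (D : {set {set V}}) n m :
  simplicial_complex D ->
  (forall v, v \in vertices D -> 0 < n v <= m) ->
  (forall x, value (vertices D) n x = m -> support (vertices D) x \in D) ->
  (forall F, F \in D ->
     exists2 x, value (vertices D) n x = m &
                F \subset support (vertices D) x) ->
  (forall v x, v \in vertices D -> value (vertices D) n x = n v ->
     support (vertices D) x \subset [set v]) ->
  exists (S : {pred nat}) (d : nat) (g : d.-tuple nat) (m : nat),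
    [/\ numerical_semigroup S, minimal_generators S g, m \in S &
        complex_iso D (squarefree_divisor_complex S g m)].
Proof.
move=> Dc; have := fun F => @face_vertices V D F Dc; have [D0 Dd] := Dc.
move UE: (vertices D) => U DU n_bounds supp_face face_supp atom.
have n_pos v : v \in U -> 0 < n v by move=> /n_bounds /andP [].
have n_le v : v \in U -> n v <= m by move=> /n_bounds /andP [].
pose S := truncated_semigroup U n m.
have HS : numerical_semigroup S := truncated_semigroupP m n_pos.
have SP a : a <= m -> reflect (exists x, value U n x = a) (a \in S).
  by move=> am; rewrite truncated_semigroup_small //; apply: representedP.
have [d [g gP]] := minimal_generators_exist HS.
have [gen _] := minimal_generatorsP HS gP; case: gP => g_uniq gP.
have val1 v : v \in U -> value U n (ind [set v]) = n v.
  by move=> vU; rewrite value_ind ?sub1set // big_set1.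
(* In a splitting n v = a + b, both a and b are multiples of n v by the last
   hypothesis. *)
have n_gen v : v \in U -> n v \in g.
  move=> vU; apply/gP/(irreducible_eltP _ HS); split=> [||a b aS bS ab].
  - by apply/(SP _ (n_le v vU)); exists (ind [set v]); apply: val1.
  - exact: n_pos.
  have le := n_le v vU.
  have /(SP a) [|x xa] := aS; first lia.
  have /(SP b) [|y yb] := bS; first lia.
  have xy : value U n (fun u => x u + y u) = n v by rewrite valueD xa yb.
  have zero u : u \in U :\ v -> x u + y u = 0.
    case/setD1P => uv uU; apply/eqP; rewrite -leqn0 leqNgt; apply/negP => pos.
    have := subsetP (atom v _ vU xy) u; rewrite !inE uU pos (negbTE uv).
    by move/(_ isT).
  have vx (z : V -> nat) : (forall u, u \in U :\ v -> z u = 0) ->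
      value U n z = z v * n v.
    move=> z0; rewrite /value (big_setD1 v) //= big1 ?addn0 // => u /z0 ->.
    by rewrite mul0n.
  have {}xa : a = x v * n v by rewrite -xa vx // => u /zero; lia.
  have {}yb : b = y v * n v by rewrite -yb vx // => u /zero; lia.
  rewrite {}xa {}yb {aS bS} in ab *.
  have : x v + y v == 1 by rewrite -(eqn_pmul2r (n_pos v vU)) mulnDl ab mul1n.
  by case: (x v) => [|[|k]]; [left|case: (y v); [right|]|].
have n_inj : {in U &, injective n}.
  move=> u v uU vU nuv.
  have /subsetP/(_ u) := atom v (ind [set u]) vU (etrans (val1 u uU) nuv).
  by rewrite /ind !inE eqxx uU => /(_ isT) /eqP.
have d_gt0 : 0 < d.
  have [|s sg sE] := (gen m.+1).1; first by rewrite inE ltnSn.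
  case: s sg sE => // a s sg _; have /tnthP [i _] := sg a (mem_head _ _).
  exact: leq_ltn_trans (leq0n i) (ltn_ord i).
pose f v := odflt (Ordinal d_gt0) [pick i | tnth g i == n v].
have fE v : v \in U -> tnth g (f v) = n v.
  move=> /n_gen /tnthP [i iE]; rewrite /f; case: pickP => [j /eqP //|/(_ i)].
  by rewrite iE eqxx.
have f_inj : {in U &, injective f}.
  by move=> u v uU vU fuv; apply: n_inj => //; rewrite -!fE // fuv.
have sum_f (F : {set V}) : F \subset U ->
    \sum_(i in f @: F) tnth g i = value U n (ind F).
  move=> /subsetP FU; rewrite value_ind; last exact/subsetP.
  rewrite big_imset => [|u v /FU uU /FU vU] /=; last exact: f_inj.
  by apply: eq_bigr => v /FU; apply: fE.
have small_gen i : tnth g i <= m -> exists2 v, v \in U & i = f v.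
  move=> im.
  have /(irreducible_eltP _ HS) [iS ipos irr] := (gP _).1 (mem_tnth i g).
  have /(SP _ im) [x xi] := iS.
  have [v vU xv] : exists2 v, v \in U & 0 < x v.
    apply/exists_inP; apply: contraLR ipos => /exists_inPn none.
    rewrite -xi /value big1 // => v /none; rewrite -eqn0Ngt => /eqP ->.
    by rewrite mul0n.
  (* The generator is n v plus a sum of weights; irreducibility makes this sum
     zero. *)
  exists v => //; apply: (tuple_uniqP _ g_uniq); rewrite fE //.
  have split_x : value U n (ind [set v]) +
      value U n (fun u => x u - ind [set v] u) = tnth g i.
    rewrite -valueD -xi; apply: eq_value => u _; apply: subnKC.
    by rewrite /ind in_set1; case: eqP => [->|].
  rewrite val1 // in split_x; have vpos := n_pos v vU.
  have restS : value U n (fun u => x u - ind [set v] u) \in S.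
    by apply/SP; [lia|eexists].
  have nvS : n v \in S.
    by apply/(SP _ (n_le v vU)); exists (ind [set v]); apply: val1.
  case: (irr _ _ nvS restS split_x) => E; first by rewrite E in vpos.
  by rewrite -split_x E addn0.
exists S, d, g, m; split=> //.
  by have [x xm _] := face_supp _ D0; apply/SP => //; exists x.
exists f; split; first by rewrite UE.
apply/setP => H; rewrite inE; apply/imsetP/andP => [[F FD ->]|[Hm HS']].
  have [x xm /subsetP Fx] := face_supp F FD; rewrite sum_f ?DU //.
  have split_x : value U n (ind F) + value U n (fun u => x u - ind F u) = m.
    rewrite -valueD -xm; apply: eq_value => u _; apply: subnKC.
    by rewrite /ind; case: (boolP (u \in F)) => // /Fx; rewrite inE => /andP [].
  split; first by rewrite -split_x leq_addr.
  by apply/SP; [apply: leq_subr|eexists; rewrite -[in RHS]split_x addKn].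
pose F := [set v in U | f v \in H].
have FU : F \subset U by apply/subsetP => v; rewrite inE => /andP [].
have HF : H = f @: F.
  apply/setP => i; apply/idP/imsetP => [iH|[v]]; last first.
    by rewrite inE => /andP [_ ? ->].
  have [|v vU iv] := small_gen i.
    by apply: leq_trans Hm; rewrite (bigD1 i) //= leq_addr.
  by exists v; rewrite // inE vU -iv.
exists F => //.
rewrite HF sum_f // in Hm HS'.
have /(SP _ (leq_subr _ _)) [x xE] := HS'.
apply: Dd (supp_face (fun v => x v + ind F v) _) _.
  by rewrite valueD xE subnK.
apply/subsetP => v vF; rewrite inE (subsetP FU) //= /ind vF; lia.
Qed.

Theorem corollary2p8 (V : finType) (D : {set {set V}}) :
  fat_forest D ->
  exists (S : {pred nat}) (d : nat) (n : d.-tuple nat) (m : nat),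
    [/\ numerical_semigroup S, minimal_generators S n, m \in S &
        complex_iso D (squarefree_divisor_complex S n m)].
Proof.
move=> /realizable_fat_forest [Dc [n [m R]]].
have [D0 Dd] := Dc.
have [v0 v0D|no_vertex] := pickP [in vertices D].
  have vD v : v \in vertices D -> [set v] \in D by rewrite inE.
  have val1 v : v \in vertices D -> value (vertices D) n (ind [set v]) = n v.
    by move=> vU; rewrite value_ind ?sub1set // big_set1.
  apply: (@semigroup_realization V D n m) => //.
  - move=> v vU; rewrite (realizes_pos R) //=.
    by have := realizes_small R (vD v vU); rewrite val1 //; lia.
  - exact: realizes_support R.
  - move=> F FD; have [->|F0] := eqVneq F set0; last first.
      exact (realizes_face R FD F0).
    have [|x xm _] := realizes_face R (vD v0 v0D).
      by apply/set0Pn; exists v0; rewrite inE.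
    by exists x; rewrite ?sub0set.
  - by move=> v x vU E; apply: (realizes_tight R (vD v vU)); rewrite val1.
(* The complex with only the empty face is realized by the target 0 with no
   weights at all. *)
have U0 : vertices D = set0 by apply/setP => v; rewrite [LHS]no_vertex inE.
apply: (@semigroup_realization V D n 0) => //; rewrite U0.
- by move=> v; rewrite inE.
- move=> x _; suff -> : support set0 x = set0 by [].
  by apply/setP => v; rewrite !inE.
- move=> F /(face_vertices Dc); rewrite U0 => F0; exists (fun=> 0).
    by rewrite /value big_set0.
  exact: subset_trans F0 (sub0set _).
- by move=> v x; rewrite inE.
Qed.
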